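(* Let $n \ge 19$ be an odd integer. Then $T(n) = \frac{3}{2}n + \frac{3}{2}$.
   Context: A (burnt) stack of $n$ pancakes is a sequence $[x_1,\dots,x_n]$, read from top to bottom, of nonzero integers such that $|x_1|,\dots,|x_n|$ is a permutation of $1,\dots,n$; a negative sign means that the burnt side of the pancake is face-up. For $1\le k\le n$, the flip $(k)$ transforms $[x_1,\dots,x_n]$ into $[-x_k,-x_{k-1},\dots,-x_1,x_{k+1},\dots,x_n]$. Let $I_n=[1,2,\dots,n]$ (the sorted stack) and $\overline{I_n}=[-1,-2,\dots,-n]$. $T(n)$ denotes the minimum number of flips required to transform $\overline{I_n}$ into $I_n$. *)

(* Defs.v *)
From mathcomp Require Import all_boot all_order all_algebra.

Set Implicit Arguments.
Unset Strict Implicit.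
Unset Printing Implicit Defensive.

Import GRing.Theory.
Local Open Scope ring_scope.

(* A stack is read from top to bottom; a negative entry is a pancake whose
   burnt side is face-up. *)
Definition is_stack (n : nat) (s : seq int) : bool :=
  perm_eq [seq absz x | x <- s] (iota 1 n).

Definition flip (k : nat) (s : seq int) : seq int :=
  rev [seq - x | x <- take k s] ++ drop k s.

Definition sorted_stack (n : nat) : seq int := [seq k%:Z | k <- iota 1 n].

Definition burnt_stack (n : nat) : seq int := [seq - k%:Z | k <- iota 1 n].

(* [ks] lists the flips from first to last; since 'I_n is {0, ..., n - 1},
   the index [k : 'I_n] stands for the flip (k + 1). *)
Definition apply_flips (n : nat) (s : seq int) (ks : seq 'I_n) : seq int :=
  foldl (fun s (k : 'I_n) => flip k.+1 s) s ks.

Definition transforms_in (n : nat) (s t : seq int) (m : nat) : bool :=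
  [exists ks : m.-tuple 'I_n, apply_flips s ks == t].

Lemma sorted_stackP (n : nat) : is_stack n (sorted_stack n).
Proof. by rewrite /is_stack /sorted_stack -map_comp map_id. Qed.

Lemma burnt_stackP (n : nat) : is_stack n (burnt_stack n).
Proof.
rewrite /is_stack /burnt_stack -map_comp (eq_map (_ : _ =1 id)) ?map_id //.
by move=> k /=; rewrite abszN.
Qed.

Lemma flip_stack (n k : nat) (s : seq int) :
  is_stack n s -> is_stack n (flip k s).
Proof.
move=> hs; apply: perm_trans hs.
rewrite /flip -{3}(cat_take_drop k s) !map_cat perm_cat2r map_rev perm_rev.
rewrite -map_comp (eq_map (_ : absz \o -%R =1 absz)) // => x /=.
exact: abszN.
Qed.

Lemma flip_flip1_flip (a b : seq int) (x : int) :
  flip (size a).+1 (flip 1 (flip (size a).+1 (a ++ x :: b))) = a ++ - x :: b.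
Proof.
have E (y : int) :
    flip (size a).+1 (a ++ y :: b) = - y :: rev [seq - z | z <- a] ++ b.
  rewrite /flip -cat_rcons take_size_cat ?size_rcons // drop_size_cat ?size_rcons //.
  by rewrite map_rcons rev_rcons.
rewrite E {2}/flip /= take0 drop0 opprK /flip /=.
rewrite take_size_cat ?size_rev ?size_map // drop_size_cat ?size_rev ?size_map //.
by rewrite rev_cons -map_rev revK mapK ?cat_rcons //; apply: opprK.
Qed.

Lemma burnt_to_sorted (n : nat) :
  exists m, transforms_in n (burnt_stack n) (sorted_stack n) m.
Proof.
suff H (a b : seq int) : size (a ++ b) = n ->
    exists ks : seq 'I_n, apply_flips (a ++ b) ks = a ++ [seq - x | x <- b].
  have [|ks hks] := H [::] (burnt_stack n); first by rewrite size_map size_iota.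
  exists (size ks); apply/existsP; exists (in_tuple ks); apply/eqP.
  by rewrite hks /= -map_comp; apply: eq_map => k /=; rewrite opprK.
elim: b a => [|x b IH] a hn; first by exists [::].
have han : (size a < n)%N by rewrite -hn size_cat /= -addSnnS leq_addr.
have hn0 : (0 < n)%N by apply: leq_ltn_trans han.
have [|ks hks] := IH (rcons a (- x)).
  by rewrite cat_rcons -hn !size_cat.
exists [:: Ordinal han, Ordinal hn0, Ordinal han & ks].
rewrite /apply_flips /= flip_flip1_flip.
by rewrite /apply_flips !cat_rcons in hks.
Qed.

Definition T (n : nat) : nat := ex_minn (burnt_to_sorted n).

(* Main.v *)
Require Import Defs.
From mathcomp Require Import all_boot all_order all_algebra.
From mathcomp Require Import zify.

(** Both bounds come from one potential function on stacks.  Say that a pair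
    (x, x + 1) of consecutive entries is an adjacency and that (x, x - 1) is
    an antiadjacency: the stack [-1, ..., -n] consists of antiadjacencies, the
    sorted stack of adjacencies.

    Lower bound.  A flip changes a single pair of neighbours, so it can
    destroy an antiadjacency and create an adjacency at the same time, but
    then the pancake that comes to the top is either followed by its own
    antiadjacent partner, and can create nothing in the next flip, or was the
    remainder of a run of two pancakes.  The right weights are therefore: 2
    for an adjacency (the table under pancake n counts as pancake n + 1), -1
    for a triple (x, x - 1, x - 2), and -1 if the two topmost pancakes are
    antiadjacent; triples rather than pairs, because cutting a long run of
    antiadjacencies loses two of them while cutting a pancake off its end
    loses one.  With these weights a flip gains at most 2.  Two boundary
    effects cost three more units: pancake -n has to leave the bottom
    ([bottom_debt]), and breaking the pair -1, -2 leads to a stack with 1 on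
    top, which is a dead end ([top_debt]).  The resulting [potential] still
    gains at most 2 in each flip ([potential_flip]), and it rises from -n - 2
    to 2n, so that at least (3n + 2) / 2 flips are needed ([reach_lower]);
    for odd n this rounds up to (3n + 3) / 2.

    Upper bound.  For n = 19 and n = 21 there are sequences of 30 and 33
    flips.  They extend to n + 4r: cut the stack into the outer pancakes and
    4r consecutive pancakes in the middle, and treat the middle as one more
    pancake.  The sequences for 19 and 21 are then interrupted three times by
    2r flips which process the middle in groups of four: every second pair of
    pancakes is pulled to the top ([reach_pulls_asc], [reach_pulls_desc]),
    the remaining ones, paired anew with a shift by one pancake, are pushed into
    the middle of the pulled pairs ([reach_pushes_asc], [reach_pushes_desc]),
    and r flips that are repeated in the reverse order after a few flips of the
    short sequence exchange the pairs in each group ([reach_unswap]).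
    Everything between the interruptions is a computation with a fixed number
    of symbols ([reach_env]).  As 19 + 4r and 21 + 4r are all the odd numbers
    from 19 on, the bounds meet. *)

Set Implicit Arguments.
Unset Strict Implicit.
Unset Printing Implicit Defensive.

Import Order.TTheory GRing.Theory Num.Theory.
Local Open Scope ring_scope.

(** * Reversed segments, neighbouring pairs and triples *)

Definition negrev (s : seq int) : seq int := rev [seq - x | x <- s].

Lemma negrev_cons x s : negrev (x :: s) = rcons (negrev s) (- x).
Proof. by rewrite /negrev /= rev_cons. Qed.

Lemma negrev_rcons x s : negrev (rcons s x) = - x :: negrev s.
Proof. by rewrite /negrev map_rcons rev_rcons. Qed.

Lemma negrev_cat s t : negrev (s ++ t) = negrev t ++ negrev s.
Proof. by rewrite /negrev map_cat rev_cat. Qed.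

Lemma negrevK : involutive negrev.
Proof.
move=> s; rewrite /negrev map_rev revK -map_comp -[RHS]map_id.
by apply: eq_map => x /=; rewrite opprK.
Qed.

Lemma size_negrev s : size (negrev s) = size s.
Proof. by rewrite /negrev size_rev size_map. Qed.

Lemma negrev_ends (t p : int) R :
  negrev (t :: rcons R p) = - p :: rcons (negrev R) (- t).
Proof. by rewrite negrev_cons negrev_rcons. Qed.

Lemma head_negrev (t : int) R : head (- t) (negrev R) = - last t R.
Proof. by case/lastP: R => [//|R x]; rewrite negrev_rcons last_rcons. Qed.

Lemma last_negrev (p : int) R : last (- p) (negrev R) = - head p R.
Proof. by case: R => [//|x R]; rewrite negrev_cons last_rcons. Qed.

Lemma nth_cons0 (x : int) s : nth 0 (x :: s) 0 = x. Proof. by []. Qed.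

Lemma nth_cons1 (x : int) s : nth 0 (x :: s) 1 = nth 0 s 0. Proof. by []. Qed.

Lemma nth0_rcons_cat (p : int) R s : nth 0 (rcons R p ++ s) 0 = head p R.
Proof. by case: R. Qed.

Lemma nth0_rcons_rev (t : int) R : nth 0 (rcons (rev R) t) 0 = last t R.
Proof. by case/lastP: R => [//|R x]; rewrite rev_rcons last_rcons. Qed.

Fixpoint pairs (f : rel int) (s : seq int) : nat :=
  if s is x :: s' then
    (if s' is y :: _ then f x y : nat else 0) + pairs f s' else 0.

Fixpoint triples (f : rel int) (s : seq int) : nat :=
  if s is x :: s' then
    (if s' is y :: z :: _ then f x y && f y z : nat else 0) + triples f s' else 0.

Lemma pairs_cons2 f x y s : pairs f [:: x, y & s] = (f x y + pairs f (y :: s))%N.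
Proof. by []. Qed.

Lemma triples_cons3 f x y z s :
  triples f [:: x, y, z & s] = ((f x y && f y z) + triples f [:: y, z & s])%N.
Proof. by []. Qed.

Lemma pairs_cat f s x y t :
  pairs f (rcons s x ++ y :: t) = (pairs f (rcons s x) + f x y + pairs f (y :: t))%N.
Proof.
elim: s => [|a s IH] /=; first by rewrite addn0.
by move: IH; case: s => [|b s] /= ->; rewrite !addnA.
Qed.

Lemma triples_cat f s x' x y y' t :
  triples f (rcons (rcons s x') x ++ y :: y' :: t) =
  (triples f (rcons (rcons s x') x) + (f x' x && f x y) + (f x y && f y y')
   + triples f (y :: y' :: t))%N.
Proof.
elim: s => [|a s IH]; first by rewrite /= !addn0 !add0n !addnA.
by move: IH; case: s => [|b [|c s]] /= ->; rewrite !addnA.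
Qed.

Lemma pairs_rcons2 f s x y :
  pairs f (rcons (rcons s x) y) = (pairs f (rcons s x) + f x y)%N.
Proof. by rewrite -(cats1 _ y) pairs_cat /= !addn0. Qed.

Lemma triples_rcons3 f s x y z :
  triples f (rcons (rcons (rcons s x) y) z) =
  (triples f (rcons (rcons s x) y) + (f x y && f y z))%N.
Proof.
elim: s => [|a s IH] /=; first by rewrite !addn0 !add0n.
by move: IH; case: s => [|b [|c s]] /= ->; rewrite !addnA.
Qed.

Lemma pairs_negrev (f : rel int) s :
  (forall x y, f (- y) (- x) = f x y) -> pairs f (negrev s) = pairs f s.
Proof.
move=> fN; elim: s => [//|x s IH]; rewrite negrev_cons.
case: s IH => [//|y s]; rewrite negrev_cons pairs_rcons2 => ->.
by rewrite fN addnC.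
Qed.

Lemma triples_negrev (f : rel int) s :
  (forall x y, f (- y) (- x) = f x y) -> triples f (negrev s) = triples f s.
Proof.
move=> fN; elim: s => [//|x s IH]; rewrite negrev_cons.
case: s IH => [//|y s]; rewrite negrev_cons.
case: s => [//|z s]; rewrite negrev_cons triples_rcons3 => ->.
by rewrite !fN andbC addnC.
Qed.

Lemma pairs_top f (t p q : int) R Q :
  pairs f (t :: rcons R p ++ q :: Q) =
  (pairs f (t :: rcons R p) + f p q + pairs f (q :: Q))%N.
Proof. by rewrite -cat_cons -rcons_cons pairs_cat. Qed.

(** * The potential *)

Definition adjacent (x y : int) : bool := y == x + 1.

Definition antiadjacent (x y : int) : bool := y == x - 1.

Definition joins12 (x y : int) : bool :=
  (x == -1) && (y == -2) || (x == 2) && (y == 1).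

Lemma adjacentN x y : adjacent (- y) (- x) = adjacent x y.
Proof. by rewrite /adjacent; lia. Qed.

Lemma antiadjacentN x y : antiadjacent (- y) (- x) = antiadjacent x y.
Proof. by rewrite /antiadjacent; lia. Qed.

Lemma joins12N x y : joins12 (- y) (- x) = joins12 x y.
Proof. by rewrite /joins12; lia. Qed.

Lemma antiadjacent_top (t : int) : antiadjacent (t + 1) t.
Proof. by rewrite /antiadjacent; lia. Qed.

(** This is [triples_cat] for a prefix t, R, p with the entry t + 1 put on top
    of it: that entry forms a triple exactly if the top pair is antiadjacent. *)
Lemma triples_top (t p q q' : int) R Q :
  triples antiadjacent (t + 1 :: t :: rcons R p ++ q :: q' :: Q) =
  (antiadjacent t (head p R) + triples antiadjacent (t :: rcons R p)
   + (antiadjacent (last t R) p && antiadjacent p q)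
   + (antiadjacent p q && antiadjacent q q')
   + triples antiadjacent (q :: q' :: Q))%N.
Proof.
have E : t + 1 :: t :: rcons R p = rcons (rcons (t + 1 :: belast t R) (last t R)) p.
  by rewrite !rcons_cons -lastI.
have -> : t + 1 :: t :: rcons R p ++ q :: q' :: Q =
          rcons (rcons (t + 1 :: belast t R) (last t R)) p ++ q :: q' :: Q.
  by rewrite -E.
rewrite triples_cat -E /= antiadjacent_top.
by case: R {E} => [|a R].
Qed.

(** The boolean core of [potential_flip_many].  A flip replaces the pair (p, q)
    by (-t, q), where t is the top pancake.  A' is [adjacent (- t) q]; a, b, g
    tell whether (p', p), (p, q), (q, q') are antiadjacent for the neighbours
    p' and q' of p and q; k is whether the two topmost pancakes are; j is
    [joins12 p q]; T1, P1 and P2 stand for t = 1, p = -1 and p' = -2, X2 for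
    the second pancake being 2, W for the presence of another 12-pair; D is
    the decrease of the bottom debt. *)
Lemma gain_arith (A' a b g k j T1 X2 P1 P2 W : bool) (D : nat) :
  (A' ==> ~~ k) -> (A' ==> ~~ g) -> (T1 ==> ~~ A') -> (T1 ==> ~~ k) ->
  (j && P1 ==> ~~ P2) -> (j && ~~ P1 ==> ~~ A') -> (j && ~~ P1 ==> ~~ g) ->
  (D <= 2)%N -> ((0 < D)%N ==> [&& ~~ A', ~~ (b && g) & j ==> P1]) ->
  ((1 < D)%N ==> a && ~~ b) ->
  (2 * A' + k + (a && b) + (b && g) + D + (W || j || T1 && ~~ X2) <=
   2 + a + (W || P1 && ~~ P2))%N.
Proof.
case: W.
  case: A'; case: k => //=; case: g => //=; case: D => [|[|[|D]]] //=;
  by case: a; case: b => //=; rewrite ?implybF.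
case: T1 => /=; case: j => /=; case: P1 => //=; case: P2 => //=;
case: A'; case: k => //=; case: g => //=; case: D => [|[|[|D]]] //=;
by case: a; case: b => //=; case: X2.
Qed.

Lemma potential_leP (p1 p2 t1 t2 o1 o2 D : nat) (d1 d2 : int) : d2 <= d1 + D%:Z ->
  (p1.*2 + t2 + D + o2 <= 2 + p2.*2 + t1 + o1)%N ->
  p1.*2%:Z - t1%:Z - d1 - o1%:Z <= p2.*2%:Z - t2%:Z - d2 - o2%:Z + 2.
Proof. lia. Qed.

Section Potential.
Variable n : nat.

(** The first copy of n + 1 turns pancake n at the bottom into an adjacency.
    The second copy only ensures that every entry of the stack has two entries
    below it; it contributes nothing. *)
Definition bottom : seq int := [:: n.+1%:Z; n.+1%:Z].

(** No adjacency can be created from a stack with 1 on top, which would need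
    pancake 0, so that the pair of the pancakes 1 and 2 cannot be broken for
    free.  When 2 is below 1 the pancakes are sorted and the debt is paid. *)
Definition top_debt (s : seq int) : bool :=
  (0 < pairs joins12 (s ++ bottom))%N
  || (nth 0 s 0 == 1) && (nth 0 (s ++ bottom) 1 != 2).

(** Here y is the lowest entry and x the entry above it.  A flip that moves -n
    away from the bottom creates no adjacency, and neither does a flip that
    separates it from -(n - 1). *)
Definition debt (x y : int) : nat :=
  (y == - n%:Z) + ((y == - n%:Z) && (x == 1 - n%:Z)).

Definition bottom_debt (s : seq int) : nat :=
  debt (nth 0 (rev s) 1) (nth 0 (rev s) 0).

Definition potential (s : seq int) : int :=
  (pairs adjacent (s ++ bottom)).*2%:Z
  - (triples antiadjacent (nth 0 s 0 + 1 :: s ++ bottom))%:Z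
  - (bottom_debt s)%:Z - (top_debt s)%:Z.

Lemma bottomE (Q : seq int) : exists (q q' : int) (Q' : seq int),
  Q ++ bottom = [:: q, q' & Q'] /\
  [\/ [/\ Q = [::], q = n.+1%:Z & q' = n.+1%:Z], Q = [:: q] /\ q' = n.+1%:Z
     | exists Q'', Q = [:: q, q' & Q''] ].
Proof.
case: Q => [|q [|q' Q]].
- by exists n.+1%:Z, n.+1%:Z, [::]; split=> //; constructor.
- by exists q, n.+1%:Z, [:: n.+1%:Z]; split=> //; constructor.
by exists q, q', (Q ++ bottom); split=> //; constructor 3; exists Q.
Qed.

Lemma stack_absz s : is_stack n s -> uniq [seq absz x | x <- s] /\
  (forall x, x \in s -> 0 < absz x <= n)%N.
Proof.
move=> hs; split; first by rewrite (perm_uniq hs) iota_uniq.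
move=> x xs; have: absz x \in iota 1 n by rewrite -(perm_mem hs) map_f.
by rewrite mem_iota; lia.
Qed.

Lemma stack_size s : is_stack n s -> size s = n.
Proof. by move/perm_size; rewrite size_map size_iota. Qed.

Lemma bottom_debt_cat t R p Q :
  bottom_debt (t :: rcons R p ++ Q) =
  match Q with
  | [::] => debt (last t R) p
  | [:: q] => debt p q
  | _ => bottom_debt Q
  end.
Proof.
rewrite -cat_cons /bottom_debt rev_cat rev_cons rev_rcons.
case: Q => [|q [|q' Q]] /=; first by rewrite nth0_rcons_rev.
  by rewrite /rev /=.
by rewrite !nth_cat !size_rev.
Qed.

Lemma debt_le2 x y : (debt x y <= 2)%N.
Proof. by rewrite /debt; case: eqP; case: eqP. Qed.

Lemma debt_full (t p p' : int) : (1 < n)%N ->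
  (0 < absz t <= n)%N -> (0 < absz p)%N -> absz t != absz p ->
  (0 < debt p' p)%N ==> [&& ~~ adjacent (- t) n.+1%:Z,
    ~~ (antiadjacent p n.+1%:Z && antiadjacent n.+1%:Z n.+1%:Z)
    & joins12 p n.+1%:Z ==> (p == -1)].
Proof.
rewrite /debt /adjacent /antiadjacent /joins12 => n1 ht hp htp.
case: (eqVneq p (- n%:Z)) => [p_n|//]; apply/implyP => _.
by apply/and3P; split; lia.
Qed.

Lemma debt2_full (p p' : int) : (1 < n)%N ->
  (1 < debt p' p)%N ==> antiadjacent p' p && ~~ antiadjacent p n.+1%:Z.
Proof.
rewrite /debt /antiadjacent => n1.
case: (eqVneq p (- n%:Z)) => [->|//]; case: (eqVneq p' (1 - n%:Z)) => [->|//] /=.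
by apply/andP; split; lia.
Qed.

Lemma debt_step (t p q : int) :
  (debt p q)%:Z <= (debt (- t) q)%:Z + ((q == - n%:Z) && (p == 1 - n%:Z) : nat)%:Z.
Proof. by rewrite /debt; case: eqP; case: eqP; case: eqP. Qed.

Lemma debt_part (t p q : int) : (1 < n)%N ->
  (0 < absz t <= n)%N -> (0 < absz p)%N -> absz t != absz p ->
  (0 < ((q == - n%:Z)%R && (p == 1 - n%:Z)%R))%N ==> [&& ~~ adjacent (- t) q,
    ~~ (antiadjacent p q && antiadjacent q n.+1%:Z)
    & joins12 p q ==> (p == -1)].
Proof.
rewrite /adjacent /antiadjacent /joins12 => n1 ht hp htp.
case: (eqVneq q (- n%:Z)) => [->|//]; case: (eqVneq p (1 - n%:Z)) => [p_n|//] /=.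
by apply/and3P; split; lia.
Qed.

(** A new adjacency (-t, q) is worth 2 and excludes the two other sources of
    gain: an antiadjacent top pair would have -q as its second entry, and a
    triple (p, q, q') would have q' = -t, but these pancakes are elsewhere.
    Without it, each of these two sources is worth 1.  The top debt is paid
    either by cutting between 2 and 1, where no triple is lost, or when 1 is
    the top pancake, where the top pair is not antiadjacent; there is no new
    adjacency in both cases.  When the bottom debt decreases, only the top pair
    is left as a source, and if it decreases by 2 then the new top pair is
    antiadjacent, which takes 1 back. *)
Lemma potential_flip_many t R p Q : (1 < n)%N ->
  is_stack n (t :: rcons R p ++ Q) ->
  potential (negrev (t :: rcons R p) ++ Q) <= potential (t :: rcons R p ++ Q) + 2.
Proof.
move=> n_gt1 hs.
have [us rs] := stack_absz hs.
have [q [q' [Q' [EQ hQ]]]] := bottomE Q.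
have x2_in : head p R \in rcons R p.
  by case: (R) => [|a R'] /=; rewrite ?mem_rcons ?inE ?eqxx.
have p'_in : last t R \in t :: R by exact: mem_last.
rewrite /potential /top_debt negrev_ends !cat_cons !bottom_debt_cat -!catA EQ.
rewrite !triples_top !pairs_top -!negrev_ends !triples_negrev ?pairs_negrev;
  try by [exact: antiadjacentN | exact: adjacentN | exact: joins12N].
rewrite !nth_cons1 !nth_cons0 !nth0_rcons_cat !head_negrev !last_negrev.
have rP x : x \in t :: rcons R p -> (0 < `|x| <= n)%N.
  by move=> xP; apply: rs; rewrite -cat_cons mem_cat xP.
have rQ x : x \in Q -> (0 < `|x| <= n)%N.
  by move=> xQ; apply: rs; rewrite -cat_cons mem_cat xQ orbT.
have dPQ x y : x \in t :: rcons R p -> y \in Q -> absz x != absz y.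
  move=> xP yQ; apply/eqP => exy; move: us.
  rewrite -cat_cons map_cat cat_uniq => /and3P[_ /hasPn/(_ (absz y)) + _].
  rewrite map_f // => /(_ isT) /negP; apply.
  by rewrite -exy map_f.
have dtp x : x \in rcons R p -> absz t != absz x.
  move=> xR; apply/eqP => etx; move: us => /= /andP[/negP]; case.
  by rewrite etx map_f // mem_cat xR.
have tP : t \in t :: rcons R p by rewrite mem_head.
have pR : p \in rcons R p by rewrite mem_rcons mem_head.
have pP : p \in t :: rcons R p by rewrite inE pR orbT.
have x2P : head p R \in t :: rcons R p by rewrite inE x2_in orbT.
have p'P : last t R \in t :: rcons R p.
  by rewrite -rcons_cons mem_rcons inE p'_in orbT.
have dq : q \in Q \/ q = n.+1%:Z.
  by case: hQ => [[_ -> _]|[-> _]|[Q'' ->]]; [right | left | left]; rewrite ?mem_head.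
have dq' : q' \in Q \/ q' = n.+1%:Z.
  case: hQ => [[_ _ ->]|[_ ->]|[Q'' ->]]; [by right | by right | left].
  by rewrite !inE eqxx orbT.
have ext x y : x \in t :: rcons R p -> (y \in Q \/ y = n.+1%:Z) -> absz x != absz y.
  move=> xP [yQ | ->]; first exact: dPQ.
  by have := rP _ xP; clear; lia.
have etq' := ext _ q' tP dq'.
have exq := ext _ q x2P dq; have ep'q := ext _ q p'P dq.
have [rt rp] := (rP _ tP, rP _ pP); have rx := rP _ x2P.
have etp := dtp _ pR.
have rq : (0 < absz q)%N by case: dq => [/rQ|->] //; case/andP.
have rq' : (0 < absz q')%N by case: dq' => [/rQ|->] //; case/andP.
clear us rs hs dPQ dtp ext dq dq' rP rQ x2_in p'_in tP pR pP x2P p'P EQ.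
move: (head p R) (last t R) exq ep'q rx => x2 p' exq ep'q rx.
move: (pairs adjacent _) (pairs adjacent _) (triples _ _) (triples _ _)
  (pairs joins12 _) (pairs joins12 _) => a1 a2 t1 t2 j1 j2.
set d1 := (X in _ - X - _ <= _); set d2 := (X in _ <= _ - X - _ + _).
have [D [dD D2 D0 D1]] : exists D : nat, [/\ d2 <= d1 + D%:Z, (D <= 2)%N,
    ((0 < D)%N ==> [&& ~~ adjacent (- t) q,
      ~~ (antiadjacent p q && antiadjacent q q') & joins12 p q ==> (p == -1)])
    & ((1 < D)%N ==> antiadjacent p' p && ~~ antiadjacent p q)].
  (* the debt depends on the flip only if at most one pancake stays in place *)
  rewrite {}/d1 {}/d2; case: hQ => [[-> -> ->]|[-> ->]|[Q'' ->]].
  - exists (debt p' p); split.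
    + by rewrite lerDr.
    + exact: debt_le2.
    + by apply: debt_full => //; case/andP: rp.
    exact: debt2_full.
  - exists ((q == - n%:Z) && (p == 1 - n%:Z) : nat); split.
    + exact: debt_step.
    + by case: (_ && _).
    + by apply: debt_part => //; case/andP: rp.
    by case: (_ && _).
  by exists 0%N; split; rewrite ?addr0.
have H1 : adjacent (- t) q ==> ~~ antiadjacent t x2.
  by rewrite /adjacent /antiadjacent; clear -exq; lia.
have H2 : adjacent (- t) q ==> ~~ antiadjacent q q'.
  by rewrite /adjacent /antiadjacent; clear -etq'; lia.
have H3 : (t == 1) ==> ~~ adjacent (- t) q by rewrite /adjacent; clear -rq; lia.
have H4 : (t == 1) ==> ~~ antiadjacent t x2 by rewrite /antiadjacent; clear -rx; lia.
have H5 : joins12 p q && (p == -1) ==> ~~ (p' == -2).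
  by rewrite /joins12; clear -ep'q; lia.
have H6 : joins12 p q && ~~ (p == -1) ==> ~~ adjacent (- t) q.
  by rewrite /joins12 /adjacent; clear -rt; lia.
have H7 : joins12 p q && ~~ (p == -1) ==> ~~ antiadjacent q q'.
  by rewrite /joins12 /antiadjacent; clear -rq'; lia.
have := gain_arith (x2 == 2) (0 < j1 + j2)%N H1 H2 H3 H4 H5 H6 H7 D2 D0 D1.
rewrite antiadjacentN -[- p == 1]/(- p == - -1) -[- p' != 2]/(- p' != - -2) !eqr_opp.
have -> : ((0 < j2 + joins12 p q + j1) = (0 < j1 + j2) || joins12 p q)%N.
  by case: joins12; clear; lia.
have : (0 < j1 + j2)%N ==> (0 < j2 + joins12 (- t) q + j1)%N.
  by case: joins12; clear; lia.
clearbody d1 d2; clear -dD.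
rewrite -orbA; move: (joins12 p q || _) (_ && (p' != _)) => o1 o2.
move: (0 < j1 + j2)%N (0 < _ + j1)%N => w w' ww'.
move: (adjacent (- t) q) (adjacent p q) (antiadjacent p' p) (antiadjacent t x2)
  (antiadjacent p q) (antiadjacent q q') (antiadjacent (- t) q)
  (antiadjacent (- x2) (- t)) => A' A a k b g e k' H.
have {}H : (2 * A' + k + (a && b) + (b && g) + D + (w || o1) <=
  2 + a + (w' || o2))%N.
  by apply: leq_trans H _; rewrite leq_add2l; case: w ww'; case: w'; case: o2.
apply: (potential_leP dD).
move: (w || o1) (w' || o2) (a && b) (b && g) (k' && e) (e && g) H => c1 c2 c3 c4 c5 c6.
clear; move: (nat_of_bool A') (nat_of_bool A) (nat_of_bool k) (nat_of_bool a) => nA' nA nk na.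
lia.
Qed.

(** For the flip (1) the pair that is cut is the top pair, so that both sources
    of gain in [potential_flip_many] come from it; the exclusions are the
    same. *)
Lemma potential_flip_one t Q : (1 < n)%N -> is_stack n (t :: Q) ->
  potential (- t :: Q) <= potential (t :: Q) + 2.
Proof.
move=> n_gt1 hs; have [us rs] := stack_absz hs; have := stack_size hs.
case: Q us rs hs => [|q Q] us rs hs /=; first by move=> n1; rewrite -n1 in n_gt1.
move=> _.
have rt : (0 < absz t <= n)%N by apply: rs; rewrite mem_head.
have rq : (0 < absz q <= n)%N by apply: rs; rewrite !inE eqxx orbT.
have [q' [Q' [EQ q'Q]]] : exists (q' : int) Q', Q ++ bottom = q' :: Q' /\
    (Q = [::] /\ q' = n.+1%:Z \/ exists Q'', Q = q' :: Q'').
  case: (Q) => [|a Q1]; first by exists n.+1%:Z, [:: n.+1%:Z]; split=> //; left.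
  by exists a, (Q1 ++ bottom); split=> //; right; exists Q1.
have rq' : (0 < absz q')%N.
  case: q'Q => [[_ ->] //|[Q'' eQ]].
  have /rs/andP[] // : q' \in [:: t, q & Q] by rewrite eQ !inE eqxx !orbT.
have [D [dD D1 D0]] : exists D : nat, [/\
    (bottom_debt [:: t, q & Q])%:Z <= (bottom_debt [:: - t, q & Q])%:Z + D%:Z, (D <= 1)%N
    & (0 < D)%N ==> [&& ~~ adjacent (- t) q, ~~ (antiadjacent t q && antiadjacent q q')
      & joins12 t q ==> (t == -1)] ].
  have E x : bottom_debt [:: x, q & Q] = if Q is [::] then debt x q else bottom_debt (q :: Q).
    rewrite /bottom_debt; case/lastP: (Q) => [//|Q1 y].
    by rewrite !rev_cons rev_rcons /=; case: (rev Q1) => [|z s] /=; case: Q1.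
  rewrite !E; case: q'Q => [[-> ->]|[Q'' ->]].
    exists ((q == - n%:Z) && (t == 1 - n%:Z) : nat); split.
    + exact: debt_step.
    + by case: (_ && _).
    case: (eqVneq q (- n%:Z)) => [->|//]; case: (eqVneq t (1 - n%:Z)) => [->|//] /=.
    rewrite /adjacent /antiadjacent /joins12.
    by clear -n_gt1; apply/and3P; split; lia.
  by exists 0%N; rewrite addr0.
have H1 : adjacent (- t) q ==> ~~ antiadjacent t q.
  by rewrite /adjacent /antiadjacent; clear -rq; lia.
have H3 : (t == 1) ==> ~~ adjacent (- t) q by rewrite /adjacent; clear -rq; lia.
have H4 : (t == 1) ==> ~~ antiadjacent t q by rewrite /antiadjacent; clear -rq; lia.
have H5 : joins12 t q && (t == -1) ==> (q != 2) by rewrite /joins12; clear; lia.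
have H6 : joins12 t q && ~~ (t == -1) ==> ~~ adjacent (- t) q.
  by rewrite /joins12 /adjacent; clear; lia.
have H7 : joins12 t q && ~~ (t == -1) ==> ~~ antiadjacent q q'.
  by rewrite /joins12 /antiadjacent; clear -rq'; lia.
rewrite /potential /top_debt !cat_cons EQ !triples_cons3 !(pairs_cons2 _ t) !(pairs_cons2 _ (- t)).
rewrite !nth_cons1 !nth_cons0 !antiadjacent_top -[- t == 1]/(- t == - -1) eqr_opp.
move: (pairs adjacent _) (triples _ _) (pairs joins12 _) (bottom_debt _) (bottom_debt _) dD
  => a c w d1 d2 dD.
have H : (2 * adjacent (- t) q + antiadjacent t q + (antiadjacent t q && antiadjacent q q')
    + D + ((0 < joins12 t q + w) || (t == 1%R) && (q != 2%R)) <=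
  2 + ((0 < joins12 (- t) q + w) || (t == (-1)%R) && (q != 2%R)))%N.
  clear -H1 H3 H4 H5 H6 H7 D1 D0; move: H1 H3 H4 H5 H6 H7 D0.
  case: D D1 => [|[|//]] _; case: (joins12 t q); case: (t == -1); case: (t == 1);
  case: (q != 2); case: (adjacent (- t) q); case: (antiadjacent t q) => //=;
  by case: (antiadjacent q q') => //=; case: (joins12 (- t) q); case: w.
apply: (potential_leP dD); move: H; rewrite !andTb.
move: (adjacent (- t) q) (adjacent t q) (antiadjacent t q) (antiadjacent (- t) q)
  (antiadjacent q q') (_ || _) (_ || _) => A' A b e g o1 o2.
move: (b && g) (e && g) => bg eg; clear.
move: (nat_of_bool A') (nat_of_bool A) (nat_of_bool b) => nA' nA nb.
lia.
Qed.

Lemma potential_flip s k : (1 < n)%N -> is_stack n s -> (0 < k <= n)%N ->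
  potential (flip k s) <= potential s + 2.
Proof.
move=> n_gt1 hs /andP[k_gt0 k_le].
have sP : size (take k s) = k by rewrite size_takel ?(stack_size hs).
rewrite /flip -/(negrev _); rewrite -{3}(cat_take_drop k s).
move: hs; rewrite -{1}(cat_take_drop k s).
case: (take k s) sP => [|t P] sP; first by rewrite -sP in k_gt0.
case/lastP: P sP => [|R p] _ hs; first exact: potential_flip_one.
exact: potential_flip_many.
Qed.

End Potential.

(** * Sequences of flips *)

Definition reach (m : nat) (s t : seq int) : Prop :=
  exists ks : seq nat, [/\ size ks = m, all (fun k => 0 < k <= size s)%N ks
    & foldl (fun s k => flip k s) s ks = t].

Lemma size_flip k s : size (flip k s) = size s.
Proof. by rewrite -{2}(cat_take_drop k s) /flip !size_cat size_rev size_map. Qed.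

Lemma size_reach m s t : reach m s t -> size t = size s.
Proof.
by case=> ks [_ _ <-]; elim: ks s => //= k ks IH s; rewrite IH size_flip.
Qed.

Lemma reach0 s : reach 0 s s.
Proof. by exists [::]. Qed.

Lemma reach_trans m1 m2 s t u : reach m1 s t -> reach m2 t u -> reach (m1 + m2) s u.
Proof.
move=> st [ks2 [<- ok2 <-]]; rewrite (size_reach st) in ok2.
case: st => ks1 [<- ok1 <-].
by exists (ks1 ++ ks2); split; rewrite ?size_cat ?all_cat ?ok1 ?ok2 ?foldl_cat.
Qed.

Lemma reach_flip p q : (0 < size p)%N -> reach 1 (p ++ q) (negrev p ++ q).
Proof.
move=> p_gt0; exists [:: size p]; split=> //=.
  by rewrite andbT p_gt0 size_cat leq_addr.
by rewrite /flip take_size_cat // drop_size_cat.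
Qed.

Lemma reach_pull s p q : (0 < size s)%N -> reach 2 (s ++ p ++ q) (negrev p ++ s ++ q).
Proof.
move=> s_gt0; apply: (reach_trans (reach_flip (p ++ q) s_gt0)).
rewrite !catA -[X in negrev p ++ X]negrevK -negrev_cat.
by apply: reach_flip; rewrite size_cat size_negrev addn_gt0 s_gt0.
Qed.

Lemma reach_push p s q : (0 < size s)%N -> reach 2 (p ++ s ++ q) (s ++ negrev p ++ q).
Proof.
move=> s_gt0; rewrite !catA; apply: (@reach_trans 1 1 _ (negrev s ++ negrev p ++ q)).
  by rewrite catA -negrev_cat; apply: reach_flip; rewrite size_cat addn_gt0 s_gt0 orbT.
by rewrite -{2}(negrevK s) -catA; apply: reach_flip; rewrite size_negrev.
Qed.

Lemma apply_flipsE n s (ks : seq 'I_n) :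
  apply_flips s ks = foldl (fun s k => flip k s) s [seq k.+1 | k : 'I_n <- ks].
Proof. by elim: ks s => [//|k ks IH] s; rewrite /apply_flips /= -IH. Qed.

Lemma transforms_inP n s t m : size s = n ->
  reflect (reach m s t) (transforms_in n s t m).
Proof.
move=> ss; apply: (iffP existsP) => [[ks /eqP <-]|[ks [<- ok <-]]].
  exists [seq k.+1 | k : 'I_n <- ks]; split; first by rewrite size_map size_tuple.
    by rewrite all_map; apply/allP => k _ /=; rewrite ss.
  by rewrite apply_flipsE.
have [js jsE] : exists js : seq 'I_n, [seq k.+1 | k : 'I_n <- js] = ks.
  rewrite ss in ok; elim: ks ok => [|[//|k] ks IH] /=; first by exists [::].
  case/andP=> k_lt /IH[js <-].
  by exists (Ordinal k_lt :: js).
have sz : size js == size ks by rewrite -jsE size_map.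
by exists (Tuple sz); rewrite apply_flipsE /= jsE.
Qed.

(** * The lower bound *)

Definition up (b k : nat) : seq int := [seq i%:Z | i <- iota b k].

Definition down (b k : nat) : seq int := [seq - i%:Z | i <- iota b k].

Lemma potential_reach n m s t : (1 < n)%N -> is_stack n s -> reach m s t ->
  potential n t <= potential n s + 2 * m%:Z.
Proof.
move=> n_gt1 hs [ks [<- ok <-]].
elim: ks s hs ok => [|k ks IH] s hs /=; first by rewrite mulr0 addr0.
case/andP=> k_ok ok; rewrite (stack_size hs) in k_ok.
have := IH _ (flip_stack k hs); rewrite size_flip => /(_ ok) le1.
by have := potential_flip n_gt1 hs k_ok; move: le1; clear; lia.
Qed.

Lemma pairs_adjacent_up b m :
  pairs adjacent (up b m ++ [:: (b + m)%:Z; (b + m)%:Z]) = m.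
Proof.
elim: m b => [|m IH] b; first by rewrite /= /adjacent; case: eqP => //; clear; lia.
have := IH b.+1; rewrite addSnnS /up /=.
by case: m {IH} => [|m] /= ->; rewrite /adjacent; clear; lia.
Qed.

Lemma pairs_joins12_up b m :
  pairs joins12 (up b.+1 m ++ [:: (b.+1 + m)%:Z; (b.+1 + m)%:Z]) = 0%N.
Proof.
elim: m b => [|m IH] b; first by rewrite /= /joins12; clear; lia.
have := IH b.+1; rewrite addSnnS /up /=.
by case: m {IH} => [|m] /= ->; rewrite /joins12; clear; lia.
Qed.

Lemma triples_up b m :
  triples antiadjacent (up b m ++ [:: (b + m)%:Z; (b + m)%:Z]) = 0%N.
Proof.
elim: m b => [|m IH] b //; have := IH b.+1; rewrite addSnnS /up.
by case: m {IH} => [|[|m]] /= ->; rewrite /antiadjacent; clear; lia.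
Qed.

Lemma pairs_adjacent_down b m c :
  pairs adjacent (down b.+1 m ++ [:: c.+1%:Z; c.+1%:Z]) = 0%N.
Proof.
elim: m b => [|m IH] b; first by rewrite /= /adjacent; clear; lia.
have := IH b.+1; rewrite /down.
by case: m {IH} => [|m] /= ->; rewrite /adjacent; clear; lia.
Qed.

Lemma triples_down b m c :
  triples antiadjacent (down b m.+2 ++ [:: c.+1%:Z; c.+1%:Z]) = m.
Proof.
elim: m b => [|m IH] b; first by rewrite /= /antiadjacent; clear; lia.
have := IH b.+1; rewrite /down.
by case: m {IH} => [|m] /= ->; rewrite /antiadjacent; clear; lia.
Qed.

Lemma bottom_debt_map n (f : nat -> int) : (1 < n)%N ->
  bottom_debt n [seq f k | k <- iota 1 n] = debt n (f n.-1) (f n).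
Proof.
move=> n_gt1; rewrite /bottom_debt !nth_rev ?size_map ?size_iota // 1?ltnW //.
by rewrite !(nth_map 0%N) ?size_iota ?nth_iota //; try lia; congr (debt _ (f _) (f _)); lia.
Qed.

Lemma potential_sorted n : (1 < n)%N -> potential n (sorted_stack n) = 2 * n%:Z.
Proof.
move=> n_gt1; rewrite /potential bottom_debt_map //.
have -> : debt n n.-1%:Z n%:Z = 0%N by rewrite /debt; clear -n_gt1; lia.
rewrite -[sorted_stack n]/(up 1 n) /top_debt /bottom -(add1n n).
rewrite pairs_adjacent_up pairs_joins12_up.
case: n n_gt1 => [|[|n]] // _ /=.
have := triples_up 1 n.+2; rewrite /= => ->.
by clear; lia.
Qed.

Lemma potential_burnt n : (1 < n)%N -> potential n (burnt_stack n) = - n%:Z - 2.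
Proof.
move=> n_gt1; rewrite /potential (bottom_debt_map (fun k => - k%:Z)) //.
have -> : debt n (- n.-1%:Z) (- n%:Z) = 2%N by rewrite /debt; clear -n_gt1; lia.
rewrite -[burnt_stack n]/(down 1 n) /top_debt /bottom pairs_adjacent_down.
case: n n_gt1 => [|[|n]] // _.
(* the entry added on top of -1, -2, ... is 0 *)
have := triples_down 0 n.+1 n.+2; rewrite /= => ->.
by clear; lia.
Qed.

Lemma reach_lower n m : (1 < n)%N -> reach m (burnt_stack n) (sorted_stack n) ->
  (3 * n + 2 <= 2 * m)%N.
Proof.
move=> n_gt1 /(potential_reach n_gt1 (burnt_stackP n)).
by rewrite potential_sorted // potential_burnt //; clear; lia.
Qed.

(** * Flips of a stack of segments *)

Section Inflation.
Variable env : nat -> seq int.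

(** A stack w of nonzero symbols is read as the stack in which the symbol k
    stands for the segment [env k] and -k for the same segment upside down. *)
Definition segment (x : int) : seq int :=
  match x with Posz k => env k | Negz k => negrev (env k.+1) end.

Definition inflate (w : seq int) : seq int := flatten [seq segment x | x <- w].

Lemma inflate_cat v w : inflate (v ++ w) = inflate v ++ inflate w.
Proof. by rewrite /inflate map_cat flatten_cat. Qed.

Lemma inflate_negrev w : 0 \notin w -> inflate (negrev w) = negrev (inflate w).
Proof.
elim: w => [//|x w IH]; rewrite inE eq_sym => /norP[x_neq0 /IH {}IH].
rewrite -cat1s negrev_cat !inflate_cat negrev_cat IH; congr (_ ++ _).
by case: x x_neq0 => [[|k]|k] _ //; rewrite /inflate /= !cats0 ?negrevK.
Qed.

Lemma inflate_flip j w : 0 \notin w ->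
  inflate (flip j w) = negrev (inflate (take j w)) ++ inflate (drop j w).
Proof.
move=> w0; rewrite /flip -/(negrev _) inflate_cat inflate_negrev //.
by apply: contra w0; apply: mem_take.
Qed.

Lemma flip_neq0 j w : 0 \notin w -> 0 \notin flip j w.
Proof.
apply: contra; rewrite /flip mem_cat mem_rev => /orP[/mapP[x /mem_take xw /eqP]|/mem_drop //].
by rewrite eq_sym oppr_eq0 => /eqP <-.
Qed.

Variable proper : pred nat.
Hypothesis properP : forall i, proper i -> (0 < size (env i))%N.

(** The flip (0) is not allowed, so every prefix that is flipped has to contain
    a symbol whose segment is known to be nonempty. *)
Definition solid w := has (fun x => proper (absz x)) w.

Lemma size_inflate_gt0 w : solid w -> (0 < size (inflate w))%N.
Proof.
elim: w => [//|x w IH] /=; rewrite -cat1s inflate_cat size_cat addn_gt0.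
case/orP=> [/properP hx|/IH ->]; last by rewrite orbT.
by case: x hx => k /= hx; rewrite /inflate /= cats0 ?size_negrev hx.
Qed.

Fixpoint playable w js : bool :=
  if js is j :: js' then solid (take j w) && playable (flip j w) js' else true.

Lemma reach_play w js : 0 \notin w -> playable w js ->
  reach (size js) (inflate w) (inflate (foldl (fun w j => flip j w) w js)).
Proof.
elim: js w => [|j js IH] w w0 /=; first by move=> _; exact: reach0.
move=> /andP[hj /(IH _ (flip_neq0 j w0))]; apply: (@reach_trans 1 (size js)).
rewrite inflate_flip // -{1}(cat_take_drop j w) inflate_cat.
by apply: reach_flip; apply: size_inflate_gt0.
Qed.

End Inflation.

(** * The middle pancakes *)

Fixpoint swapped (b r : nat) : seq int :=
  if r is r'.+1 then
    [:: (b + 2)%:Z; (b + 3)%:Z; b%:Z; (b + 1)%:Z] ++ swapped (b + 4) r'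
  else [::].

Lemma swapped_snoc b k : swapped b k.+1 = swapped b k ++
  [:: (b + 4 * k + 2)%:Z; (b + 4 * k + 3)%:Z; (b + 4 * k)%:Z; (b + 4 * k + 1)%:Z].
Proof.
elim: k b => [|k IH] b; first by rewrite /= muln0 addn0.
by rewrite -[LHS]/([:: _; _; _; _] ++ swapped (b + 4) k.+1) IH /= mulnS !addnA.
Qed.

(** If p and p' are the two pairs of the first group, then flipping a ++ p and
    at the end -p' ++ a has the effect of exchanging p and p' and of using
    (-p) ++ (-a) ++ p' in place of a for the other groups.  The m flips in
    between only have to turn a prefix d of the right length, whatever it
    contains; what they do below it (from z to z') is arbitrary. *)
Lemma reach_unswap m r b (a z z' : seq int) : (0 < size a)%N ->
  (forall d, size d = (size a + 4 * r)%N -> reach m (d ++ z) (negrev d ++ z')) ->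
  reach (m + 2 * r) (a ++ swapped b r ++ z) (negrev a ++ up b (4 * r) ++ z').
Proof.
elim: r b a => [|r IH] b a a_gt0 H.
  by rewrite muln0 addn0; apply: H; rewrite muln0 addn0.
set p := [:: (b + 2)%:Z; (b + 3)%:Z]; set p' := [:: b%:Z; (b + 1)%:Z].
have -> : (m + 2 * r.+1 = 1 + (m + 2 * r) + 1)%N by lia.
apply: (@reach_trans _ _ _ (negrev (negrev p ++ negrev a ++ p') ++ up (b + 4) (4 * r) ++ z')).
  apply: (@reach_trans _ _ _ ((negrev p ++ negrev a ++ p') ++ swapped (b + 4) r ++ z)).
    have := @reach_flip (a ++ p) (p' ++ swapped (b + 4) r ++ z).
    rewrite size_cat addn_gt0 a_gt0 negrev_cat /p /p' /= -!catA /=; exact.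
  apply: IH; first by rewrite !size_cat !size_negrev.
  move=> d; rewrite !size_cat !size_negrev /p /p' /= => hd.
  by apply: H; rewrite hd; lia.
have := @reach_flip (negrev p' ++ a) (p ++ up (b + 4) (4 * r) ++ z') isT.
rewrite !negrev_cat !negrevK -!catA.
have -> : up b (4 * r.+1) = p' ++ p ++ up (b + 4) (4 * r).
  by rewrite mulnS /up iotaD map_cat /p /p' /= !addn1 addn2 addn3.
by rewrite -!catA.
Qed.

(** In the sequence for 19 + 4r pancakes the middle has its small labels on
    top when the pulls begin, in that for 21 + 4r pancakes its large labels;
    this is the reason for the two versions of the definitions below.  Pulled
    pairs arrive upside down, kept pairs stay in place; the shifted pairs
    consist of the second entry of a kept pair and of the first entry of the
    next kept pair, or of the outer pancake that follows the last one. *)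
Fixpoint pulled_asc (b k : nat) : seq int :=
  if k is k'.+1 then [:: (b + 3)%:Z; (b + 2)%:Z] ++ pulled_asc (b + 4) k' else [::].

Fixpoint kept_asc (b k : nat) : seq int :=
  if k is k'.+1 then [:: - b%:Z; - (b + 1)%:Z] ++ kept_asc (b + 4) k' else [::].

Fixpoint shifted_asc (b k : nat) : seq int :=
  if k is k'.+1 then [:: - (b + 1)%:Z; - (b + 4)%:Z] ++ shifted_asc (b + 4) k'
  else [::].

Lemma kept_asc_shift b k :
  kept_asc b k ++ [:: - (b + 4 * k)%:Z] = - b%:Z :: shifted_asc b k.
Proof.
elim: k b => [|k IH] b /=; first by rewrite muln0 addn0.
by have := IH (b + 4)%N; rewrite -addnA -mulnS => ->.
Qed.

(** The lowest pair is pulled first, so that the other pairs are part of the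
    prefix that returns to its place. *)
Lemma reach_pulls_asc b k s q : (0 < size s)%N ->
  reach (2 * k) (s ++ down b (4 * k) ++ q) (pulled_asc b k ++ s ++ kept_asc b k ++ q).
Proof.
elim: k b s => [|k IH] b s s_gt0; first by rewrite muln0 /=; exact: reach0.
set v := [:: - b%:Z; - (b + 1)%:Z]; set u := [:: - (b + 2)%:Z; - (b + 3)%:Z].
have -> : down b (4 * k.+1) = v ++ u ++ down (b + 4) (4 * k).
  by rewrite mulnS /down iotaD map_cat /v /u /= !addn1 addn2 addn3.
rewrite mulnS addnC.
have := IH (b + 4)%N (s ++ v ++ u); rewrite size_cat addn_gt0 s_gt0 => /(_ isT).
rewrite -!catA => /reach_trans; apply.
have := @reach_pull (pulled_asc (b + 4) k ++ s ++ v) u (kept_asc (b + 4) k ++ q).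
rewrite !size_cat addn_gt0 orbC addn_gt0 s_gt0 => /(_ isT); rewrite -!catA.
by rewrite /u /negrev /rev /= !opprK.
Qed.

(** Each shifted pair goes into the middle of a pulled pair and meets its two
    neighbours there. *)
Lemma reach_pushes_asc b k s q : (0 < size s)%N ->
  reach (2 * k) (shifted_asc b k ++ s ++ pulled_asc b k ++ q)
    (s ++ swapped (b + 1) k ++ q).
Proof.
elim: k b s => [|k IH] b s s_gt0; first by rewrite muln0 /=; exact: reach0.
rewrite mulnS /=.
have := @reach_push [:: - (b + 1)%:Z; - (b + 4)%:Z]
  (shifted_asc (b + 4) k ++ s ++ [:: (b + 3)%:Z])
  ((b + 2)%:Z :: pulled_asc (b + 4) k ++ q).
rewrite !size_cat !addn_gt0 s_gt0 orbT => /(_ isT); rewrite -!catA /=.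
move/reach_trans; apply.
have := IH (b + 4)%N (s ++ [:: (b + 3)%:Z; (b + 4)%:Z; (b + 1)%:Z; (b + 2)%:Z]).
rewrite !size_cat !addn_gt0 s_gt0 => /(_ isT); rewrite -!catA /=.
by rewrite /negrev /rev /= !opprK -!addnA.
Qed.

Fixpoint pulled_desc (b k : nat) : seq int :=
  if k is k'.+1 then
    [:: - (b + 4 * k' + 1)%:Z; - (b + 4 * k' + 2)%:Z] ++ pulled_desc b k'
  else [::].

Fixpoint kept_desc (b k : nat) : seq int :=
  if k is k'.+1 then
    [:: (b + 4 * k' + 4)%:Z; (b + 4 * k' + 3)%:Z] ++ kept_desc b k'
  else [::].

Fixpoint shifted_desc (b k : nat) : seq int :=
  if k is k'.+1 then [:: (b + 4 * k' + 3)%:Z; (b + 4 * k')%:Z] ++ shifted_desc b k'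
  else [::].

Lemma kept_desc_shift b k :
  kept_desc b k ++ [:: b%:Z] = (b + 4 * k)%:Z :: shifted_desc b k.
Proof.
elim: k => [|k IH] /=; first by rewrite muln0 addn0.
by rewrite IH mulnS (addnC 4) addnA.
Qed.

Lemma reach_pulls_desc b k s q : (0 < size s)%N ->
  reach (2 * k) (s ++ negrev (down b.+1 (4 * k)) ++ q)
    (pulled_desc b k ++ s ++ kept_desc b k ++ q).
Proof.
elim: k s => [|k IH] s s_gt0; first by rewrite muln0 /=; exact: reach0.
set v := [:: (b + 4 * k + 4)%:Z; (b + 4 * k + 3)%:Z].
set u := [:: (b + 4 * k + 2)%:Z; (b + 4 * k + 1)%:Z].
have -> : negrev (down b.+1 (4 * k.+1)) = v ++ u ++ negrev (down b.+1 (4 * k)).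
  rewrite mulnS addnC /down iotaD map_cat negrev_cat /v /u /negrev /rev /= !opprK.
  by rewrite addSn !addnS !addn0.
rewrite mulnS addnC.
have := IH (s ++ v ++ u); rewrite size_cat addn_gt0 s_gt0 => /(_ isT).
rewrite -!catA => /reach_trans; apply.
have := @reach_pull (pulled_desc b k ++ s ++ v) u (kept_desc b k ++ q).
by rewrite !size_cat addn_gt0 orbC addn_gt0 s_gt0 => /(_ isT); rewrite -!catA.
Qed.

Lemma reach_pushes_desc b k s q : (0 < size s)%N ->
  reach (2 * k) (shifted_desc b k ++ s ++ pulled_desc b k ++ q)
    (s ++ negrev (swapped b k) ++ q).
Proof.
elim: k s => [|k IH] s s_gt0; first by rewrite muln0 /=; exact: reach0.
rewrite swapped_snoc negrev_cat mulnS /=.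
have := @reach_push [:: (b + 4 * k + 3)%:Z; (b + 4 * k)%:Z]
  (shifted_desc b k ++ s ++ [:: - (b + 4 * k + 1)%:Z])
  (- (b + 4 * k + 2)%:Z :: pulled_desc b k ++ q).
rewrite !size_cat !addn_gt0 s_gt0 orbT => /(_ isT); rewrite -!catA /=.
move/reach_trans; apply.
have := IH (s ++ [:: - (b + 4 * k + 1)%:Z; - (b + 4 * k)%:Z; - (b + 4 * k + 3)%:Z;
   - (b + 4 * k + 2)%:Z]).
by rewrite !size_cat !addn_gt0 s_gt0 => /(_ isT); rewrite -!catA.
Qed.

(** * The two sequences of flips *)

Section Families.
Variable r : nat.

(** The symbols up to lo are the outer pancakes below the middle labels, those
    from lo + 1 to hi are the outer pancakes above them, whose labels are larger
    by 4r than in the stack of hi pancakes; the following symbols stand for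
    parts of the middle.  For r = 0 the stack of symbols without the middle is the stack
    itself. *)
Definition env (lo hi : nat) (mid : seq (seq int)) (i : nat) : seq int :=
  if (i <= lo)%N then [:: i%:Z]
  else if (i <= hi)%N then [:: (4 * r + i)%:Z] else nth [::] mid (i - hi.+1).

Lemma env_proper lo hi mid i : (i <= hi)%N -> (0 < size (env lo hi mid i))%N.
Proof. by rewrite /env => ->; case: ifP. Qed.

Lemma reach_env lo hi mid w js : 0 \notin w -> playable (leq^~ hi) w js ->
  reach (size js) (inflate (env lo hi mid) w)
    (inflate (env lo hi mid) (foldl (fun w j => flip j w) w js)).
Proof. exact: reach_play (@env_proper lo hi mid) w js. Qed.

Lemma iota_split a b : iota 1 (a + (4 * r + b)) =
  iota 1 a ++ iota a.+1 (4 * r) ++ [seq (4 * r + i)%N | i <- iota a.+1 b].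
Proof. by rewrite -iotaDl iotaD add1n iotaD (addnC (4 * r)). Qed.

(** For r = 0 the flips are 19 10 4, 6 18 10, 4 7 14 19 14 7 4 10 18 6 4,
    10 19 14, 4 9 11 8 18 8 11 9 4 14.  At the first comma the pairs of the
    middle are pulled, at the second the shifted pairs are pushed, and the flips
    10 19 14 are the ones that are enclosed by [reach_unswap].  The numbers
    below count symbols, with 20 and 21 for the parts of the middle: a flip of
    10 + 4r pancakes is a flip of 11 symbols. *)
Lemma reach_19 :
  reach (30 + 6 * r) (burnt_stack (19 + 4 * r)) (sorted_stack (19 + 4 * r)).
Proof.
have -> : burnt_stack (19 + 4 * r) = inflate (env 16 19 [:: down 17 (4 * r)])
    [:: -1; -2; -3; -4; -5; -6; -7; -8; -9; -10; -11; -12; -13; -14; -15; -16;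
    20; -17; -18; -19]%Z.
  rewrite (_ : 19 + 4 * r = 16 + (4 * r + 3))%N; last by lia.
  by rewrite /burnt_stack iota_split !map_cat -map_comp.
have -> : sorted_stack (19 + 4 * r) = inflate (env 17 19 [:: up 18 (4 * r)])
    [:: 1; 2; 3; 4; 5; 6; 7; 8; 9; 10; 11; 12; 13; 14; 15; 16; 17; 20; 18; 19]%Z.
  rewrite (_ : 19 + 4 * r = 17 + (4 * r + 2))%N; last by lia.
  by rewrite /sorted_stack iota_split !map_cat -map_comp.
rewrite (_ : 30 + 6 * r =
  3 + (2 * r + (3 + (2 * r + (11 + ((3 + 2 * r) + 10))))))%N; last by lia.
have := @reach_env 16 19 [:: down 17 (4 * r)]
  [:: -1; -2; -3; -4; -5; -6; -7; -8; -9; -10; -11; -12; -13; -14; -15; -16;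
    20; -17; -18; -19]%Z
  [:: 20; 11; 4]%N isT isT.
move/reach_trans; apply.
have := @reach_pulls_asc 17 r
  (inflate (env 16 19 [::])
    [:: 13; 12; 11; 10; -14; -15; -16]%Z)
  (inflate (env 16 19 [::])
    [:: -17; -18; -19; 9; 8; 7; 6; 5; 4; 3; 2; 1]%Z) isT.
move/reach_trans; apply.
(* the pancake 17 joins the outer ones in place of 17 + 4r *)
have -> : kept_asc 17 r ++ (inflate (env 16 19 [::])
    [:: -17; -18; -19; 9; 8; 7; 6; 5; 4; 3; 2; 1]%Z)
  = inflate (env 17 19 [:: shifted_asc 17 r])
    [:: -17; 20; -18; -19; 9; 8; 7; 6; 5; 4; 3; 2; 1]%Z.
  transitivity ((kept_asc 17 r ++ [:: - (17 + 4 * r)%:Z])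
    ++ (inflate (env 16 19 [::])
      [:: -18; -19; 9; 8; 7; 6; 5; 4; 3; 2; 1]%Z)).
    by rewrite -catA addnC.
  by rewrite kept_asc_shift.
have := @reach_env 17 19 [:: shifted_asc 17 r; pulled_asc 17 r]
  [:: 21; 13; 12; 11; 10; -14; -15; -16; -17; 20; -18; -19; 9; 8; 7; 6; 5; 4;
    3; 2; 1]%Z
  [:: 7; 20; 11]%N isT isT.
move/reach_trans; apply.
have := @reach_pushes_asc 17 r
  (inflate (env 17 19 [::])
    [:: -18; -19; 9; 8; 7; 6; 5; 4; 3; 2; 17; 16]%Z)
  (inflate (env 17 19 [::])
    [:: 13; 12; 11; 10; -14; -15; 1]%Z) isT.
move/reach_trans; apply.
have := @reach_env 17 19 [:: swapped 18 r]
  [:: -18; -19; 9; 8; 7; 6; 5; 4; 3; 2; 17; 16; 20; 13; 12; 11; 10; -14; -15;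
    1]%Z
  [:: 4; 7; 15; 20; 14; 7; 4; 10; 19; 7; 4]%N isT isT.
move/reach_trans; apply.
have := @reach_unswap 3 r 18
  (inflate (env 17 19 [::])
    [:: -17; -2; -1; 15; 16]%Z)
  (inflate (env 17 19 [::])
    [:: 13; 14; -10; -9; 19; 18; 7; 8; 4; 3; 6; 5; 11; 12]%Z)
  (inflate (env 17 19 [::])
    [:: 18; 7; 8; 4; 3; 6; 5; 11; 12; 13; 14; -10; -9; 19]%Z) isT.
move=> H; apply: reach_trans (H _) _ => [d _|].
  exact: (@reach_env 17 19 [:: d]
    [:: 20; 13; 14; -10; -9; 19; 18; 7; 8; 4; 3; 6; 5; 11; 12]%Z
    [:: 6; 15; 10]%N isT isT).
exact: (@reach_env 17 19 [:: up 18 (4 * r)]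
  [:: -16; -15; 1; 2; 17; 20; 18; 7; 8; 4; 3; 6; 5; 11; 12; 13; 14; -10; -9;
    19]%Z
  [:: 4; 10; 12; 9; 19; 8; 11; 9; 4; 14]%N isT isT).
Qed.

(** For r = 0 the flips are 21 13 19 8, 4 16 3 5 20 11 13 9 21 9 13 11 5 3 16 19
    11, 15 11 3 5 18 4, 10, 20 8 5 3 15, where the commas have the same meaning
    as before and [reach_unswap] encloses the single flip 10; the parts of the
    middle are the symbols 22 and 23. *)
Lemma reach_21 :
  reach (33 + 6 * r) (burnt_stack (21 + 4 * r)) (sorted_stack (21 + 4 * r)).
Proof.
have -> : burnt_stack (21 + 4 * r) = inflate (env 6 21 [:: down 7 (4 * r)])
    [:: -1; -2; -3; -4; -5; -6; 22; -7; -8; -9; -10; -11; -12; -13; -14; -15;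
    -16; -17; -18; -19; -20; -21]%Z.
  rewrite (_ : 21 + 4 * r = 6 + (4 * r + 15))%N; last by lia.
  by rewrite /burnt_stack iota_split !map_cat -map_comp.
have -> : sorted_stack (21 + 4 * r) = inflate (env 5 21 [:: up 6 (4 * r)])
    [:: 1; 2; 3; 4; 5; 22; 6; 7; 8; 9; 10; 11; 12; 13; 14; 15; 16; 17; 18; 19;
    20; 21]%Z.
  rewrite (_ : 21 + 4 * r = 5 + (4 * r + 16))%N; last by lia.
  by rewrite /sorted_stack iota_split !map_cat -map_comp.
rewrite (_ : 33 + 6 * r =
  4 + (2 * r + (17 + (2 * r + (6 + ((1 + 2 * r) + 5))))))%N; last by lia.
have := @reach_env 6 21 [:: down 7 (4 * r)]
  [:: -1; -2; -3; -4; -5; -6; 22; -7; -8; -9; -10; -11; -12; -13; -14; -15;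
    -16; -17; -18; -19; -20; -21]%Z
  [:: 22; 13; 20; 9]%N isT isT.
move/reach_trans; apply.
have := @reach_pulls_desc 6 r
  (inflate (env 6 21 [::])
    [:: -20; -21; 8; 7]%Z)
  (inflate (env 6 21 [::])
    [:: 6; 5; 4; 3; 19; 18; 17; 16; 15; 14; 13; 12; 11; 10; 9; 2; 1]%Z) isT.
move/reach_trans; apply.
(* the pancake 6 + 4r joins the outer ones in place of 6 *)
have -> : kept_desc 6 r ++ (inflate (env 6 21 [::])
    [:: 6; 5; 4; 3; 19; 18; 17; 16; 15; 14; 13; 12; 11; 10; 9; 2; 1]%Z)
  = inflate (env 5 21 [:: shifted_desc 6 r])
    [:: 6; 22; 5; 4; 3; 19; 18; 17; 16; 15; 14; 13; 12; 11; 10; 9; 2; 1]%Z.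
  transitivity ((kept_desc 6 r ++ [:: 6%:Z])
    ++ (inflate (env 6 21 [::])
      [:: 5; 4; 3; 19; 18; 17; 16; 15; 14; 13; 12; 11; 10; 9; 2; 1]%Z)).
    by rewrite -catA.
  by rewrite kept_desc_shift addnC.
have := @reach_env 5 21 [:: shifted_desc 6 r; pulled_desc 6 r]
  [:: 23; -20; -21; 8; 7; 6; 22; 5; 4; 3; 19; 18; 17; 16; 15; 14; 13; 12; 11;
    10; 9; 2; 1]%Z
  [:: 5; 18; 3; 5; 22; 13; 15; 9; 23; 9; 15; 13; 5; 3; 18; 21; 12]%N isT isT.
move/reach_trans; apply.
have := @reach_pushes_desc 6 r
  (inflate (env 5 21 [::])
    [:: 5; -1; 16; 17; 14; 15; -12; -13; -10; -11; -7; -6]%Z)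
  (inflate (env 5 21 [::])
    [:: -20; -19; -18; -4; -3; -2; -9; -8; 21]%Z) isT.
move/reach_trans; apply.
have := @reach_env 5 21 [:: swapped 6 r]
  [:: 5; -1; 16; 17; 14; 15; -12; -13; -10; -11; -7; -6; -22; -20; -19; -18;
    -4; -3; -2; -9; -8; 21]%Z
  [:: 16; 12; 3; 5; 19; 4]%N isT isT.
move/reach_trans; apply.
have := @reach_unswap 1 r 6
  (inflate (env 5 21 [::])
    [:: -5; -4; -3; -2; -1; 16; 17; 18; 19; 20]%Z)
  (inflate (env 5 21 [::])
    [:: 6; 7; 11; 12; -15; -14; -13; -10; -9; -8; 21]%Z)
  (inflate (env 5 21 [::])
    [:: 6; 7; 11; 12; -15; -14; -13; -10; -9; -8; 21]%Z) isT.
move=> H; apply: reach_trans (H _) _ => [d hd|].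
  by apply: reach_flip; rewrite hd.
exact: (@reach_env 5 21 [:: up 6 (4 * r)]
  [:: -20; -19; -18; -17; -16; 1; 2; 3; 4; 5; 22; 6; 7; 11; 12; -15; -14; -13;
    -10; -9; -8; 21]%Z
  [:: 21; 8; 5; 3; 16]%N isT isT).
Qed.

End Families.

(** * The number of flips *)

Theorem corollary1 (n : nat) (n_ge19 : (19 <= n)%N) (n_odd : odd n) :
  (T n)%:R = 3 / 2 * n%:R + 3 / 2 :> rat.
Proof.
suff e : (2 * T n = 3 * n + 3)%N.
  have /(congr1 (fun m => m%:R : rat)) := e.
  rewrite natrM natrD natrM => {}e; apply: (@mulfI _ 2%:R) => //.
  by rewrite e mulrDr mulrA ![2 * (3 / 2)]mulrC !divfK.
have sz : size (burnt_stack n) = n by rewrite size_map size_iota.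
have nE := odd_double_half n; rewrite n_odd in nE.
rewrite /T; case: ex_minnP => m /(transforms_inP _ _ sz) mP m_min.
have := reach_lower (leq_trans (isT : 1 < 19)%N n_ge19) mP.
suff: (m <= (3 * n + 3)./2)%N by move: nE; clear; lia.
apply/m_min/(transforms_inP _ _ sz).
have [r [nr|nr]] : exists r, n = (19 + 4 * r)%N \/ n = (21 + 4 * r)%N.
- exists ((n - 19) %/ 4)%N; move: nE n_ge19; clear; lia.
- rewrite nr (_ : (3 * (19 + 4 * r) + 3)./2 = 30 + 6 * r)%N; last by clear; lia.
  exact: reach_19.
rewrite nr (_ : (3 * (21 + 4 * r) + 3)./2 = 33 + 6 * r)%N; last by clear; lia.
exact: reach_21.
Qed.
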